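(* Let $N=2n$ with $n\ge2$, and let $\{h_{a,b}(z)\}_{a,b\in\mathbb Z}$ be a family of elements of $\mathbf k[[z]]$. Assume that $\lambda_{a,b}:=\prod_{k=b}^{b+N-1}h_{a,k}(0)$ ($a,b\in\mathbb Z$) satisfies $$\lambda_{a,a}=1\ (a\in\mathbb Z)\quad\text{and}\quad\lambda_{a,b}\lambda_{b,a}=1\ (a,b\in\mathbb Z).$$ Then there exists a family $\{c_{a,b}(u,v)\}_{a,b\in\mathbb Z}$ of elements of $\mathbf k[[u,v]]$ satisfying $$c_{a,a}(u,v)=1\ (a\in\mathbb Z),\qquad c_{a,b}(u,v)\,c_{b,a}(v,u)=1\ (a,b\in\mathbb Z),\qquad h_{a,b}(z)=\prod_{k=a}^{a+N-1}c_{k,b}(0,z)\ (a,b\in\mathbb Z).$$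
   Context: $\mathbf k$ is the algebraic closure of $\mathbb C(q)$ in $\bigcup_{m>0}\mathbb C((q^{1/m}))$, $q$ an indeterminate. *)

(* Defs.v *)
From HB Require Import structures.
From mathcomp Require Import all_boot all_order all_algebra.
From mathcomp Require Import boolp classical_sets functions cardinality fsbigop.
From mathcomp Require Import reals.
From mathcomp Require Import complex ring.

Set Implicit Arguments.
Unset Strict Implicit.
Unset Printing Implicit Defensive.

Import Order.TTheory GRing.Theory Num.Theory.
Local Open Scope ring_scope.

(* The series \sum_i (f i) z^i is encoded by its coefficient function. *)
Record fps (A : Type) := Fps { fps_coef :> nat -> A }.

Notation "{ 'fps' A }" := (fps A) (format "{ 'fps'  A }") : type_scope.

Section FpsChoice.
Variable A : Type.

Lemma fpsP (f g : {fps A}) : (forall i, f i = g i) -> f = g.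
Proof. by case: f g => [f] [g] /= /funext ->. Qed.

HB.instance Definition _ := gen_eqMixin {fps A}.
HB.instance Definition _ := gen_choiceMixin {fps A}.

End FpsChoice.

Section FpsRing.
Variable A : comNzRingType.
Implicit Types f g h : {fps A}.

Definition fps_zero : {fps A} := Fps (fun=> 0).
Definition fps_one : {fps A} := Fps (fun i => (i == 0%N)%:R).
Definition fps_opp f : {fps A} := Fps (fun i => - f i).
Definition fps_add f g : {fps A} := Fps (fun i => f i + g i).
Definition fps_mul f g : {fps A} :=
  Fps (fun i => \sum_(j < i.+1) f j * g (i - j)%N).

Fact fps_addA : associative fps_add.
Proof. by move=> f g h; apply: fpsP => i /=; rewrite addrA. Qed.
Fact fps_addC : commutative fps_add.
Proof. by move=> f g; apply: fpsP => i /=; rewrite addrC. Qed.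
Fact fps_add0 : left_id fps_zero fps_add.
Proof. by move=> f; apply: fpsP => i /=; rewrite add0r. Qed.
Fact fps_addN : left_inverse fps_zero fps_opp fps_add.
Proof. by move=> f; apply: fpsP => i /=; rewrite addNr. Qed.

HB.instance Definition _ :=
  GRing.isZmodule.Build {fps A} fps_addA fps_addC fps_add0 fps_addN.

Fact fps_mulE f g i :
  fps_mul f g i = \sum_(j < i.+1) f j * g (i - j)%N.
Proof. by []. Qed.

Fact fps_mul_rev f g i :
  fps_mul f g i = \sum_(j < i.+1) f (i - j)%N * g j.
Proof.
rewrite /= (reindex_inj rev_ord_inj) /=.
by apply: eq_bigr => j _; rewrite subSS subKn // -ltnS.
Qed.

Fact fps_mulC : commutative fps_mul.
Proof.
move=> f g; apply: fpsP => i; rewrite fps_mul_rev /=.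
by apply: eq_bigr => j _; rewrite mulrC.
Qed.

Fact fps_mulA : associative fps_mul.
Proof.
move=> f g h; apply: fpsP => i; rewrite [RHS]fps_mul_rev [LHS]fps_mulE.
pose c3 j k := f j * (g (i - j - k)%N * h k).
transitivity (\sum_(j < i.+1) \sum_(k < i.+1 | (k <= i - j)%N) c3 j k).
  apply: eq_bigr => j _; rewrite fps_mul_rev big_distrr /=.
  by rewrite (big_ord_narrow_leq (leq_subr _ _)).
rewrite (exchange_big_dep predT) //=; apply: eq_bigr => k _.
transitivity (\sum_(j < i.+1 | (j <= i - k)%N) c3 j k).
  apply: eq_bigl => j; rewrite -ltnS -(ltnS j) -!subSn ?leq_ord //.
  by rewrite -subn_gt0 -(subn_gt0 j) -!subnDA addnC.
rewrite (big_ord_narrow_leq (leq_subr _ _)) /= big_distrl /=.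
by apply: eq_bigr => j _; rewrite /c3 /= -!subnDA addnC mulrA.
Qed.

Fact fps_mul1 : left_id fps_one fps_mul.
Proof.
move=> f; apply: fpsP => i /=; rewrite big_ord_recl /= mul1r subn0.
by rewrite big1 ?addr0 // => j _; rewrite mul0r.
Qed.

Fact fps_mulDl : left_distributive fps_mul fps_add.
Proof.
move=> f g h; apply: fpsP => i /=; rewrite -big_split /=.
by apply: eq_bigr => j _; rewrite mulrDl.
Qed.

Fact fps_one_neq0 : fps_one != 0.
Proof.
apply/eqP => /(congr1 (fun f : {fps A} => f 0%N)) /= /eqP.
by rewrite oner_eq0.
Qed.

HB.instance Definition _ := GRing.Zmodule_isComNzRing.Build {fps A}
  fps_mulA fps_mulC fps_mul1 fps_mulDl fps_one_neq0.

Lemma fps0E i : (0 : {fps A}) i = 0. Proof. by []. Qed.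
Lemma fpsDE f g i : (f + g) i = f i + g i. Proof. by []. Qed.
Lemma fpsNE f i : (- f) i = - f i. Proof. by []. Qed.
Lemma fps1E i : (1 : {fps A}) i = (i == 0%N)%:R. Proof. by []. Qed.
Lemma fpsME f g i : (f * g) i = \sum_(j < i.+1) f j * g (i - j)%N.
Proof. by []. Qed.

End FpsRing.

Section FpsTwoVariables.
Variable A : comNzRingType.

(* A[[u, v]] is encoded as {fps {fps A}}, the outer variable being u: c i j is
   the coefficient of u^i v^j.  *)
Definition fps_swap (c : {fps {fps A}}) : {fps {fps A}} :=
  Fps (fun i => Fps (fun j => c j i)).

Lemma fps_sumE (I : Type) (s : seq I) (F : I -> {fps A}) j :
  (\sum_(i <- s) F i) j = \sum_(i <- s) F i j.
Proof. by elim/big_rec2: _ => // i x y _ <-. Qed.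

Lemma fps2ME (c d : {fps {fps A}}) i j : (c * d) i j =
  \sum_(k < i.+1) \sum_(l < j.+1) c k l * d (i - k)%N (j - l)%N.
Proof. by rewrite fpsME fps_sumE. Qed.

End FpsTwoVariables.

(* Setting z = 0 in A[[z]]; on {fps {fps A}} it sends c(u, v) to c(0, v). *)
Definition fps_at0 (A : Type) (f : {fps A}) : A := f 0%N.

Section FpsInv.
Variable F : fieldType.
Implicit Types f g : {fps F}.

Lemma fps_inv_exists f : f 0%N != 0 -> exists g, g * f = 1.
Proof.
move=> f0.
pose step (s : seq F) :=
  - (f 0%N)^-1 * \sum_(j < size s) nth 0 s j * f (size s - j)%N.
pose build := fix build n := if n is m.+1 then rcons (build m) (step (build m))
  else [:: (f 0%N)^-1].
have sz n : size (build n) = n.+1 by elim: n => //= n IH; rewrite size_rcons IH.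
pose g := fun i => nth 0 (build i) i.
have gE n i : (i <= n)%N -> nth 0 (build n) i = g i.
  elim: n => [|n IH]; first by rewrite leqn0 => /eqP ->.
  rewrite leq_eqVlt => /predU1P[-> //|lt_in] /=.
  by rewrite nth_rcons sz lt_in IH.
exists (Fps g); apply: fpsP => -[|n]; rewrite fpsME fps1E /=.
  by rewrite big_ord1 mulVf.
rewrite big_ord_recr /= subnn {2}/g /= nth_rcons sz ltnn eqxx /step sz.
under [X in - _ * X]eq_bigr => j _ do rewrite gE -1?ltnS //.
by rewrite mulrAC mulNr mulVf // mulN1r subrr.
Qed.

End FpsInv.

(* f r is the coefficient of q^r, so that the union over m of the fields
   C((q^(1/m))) consists of the f whose support lies in (1/m) Z for some m and
   is bounded below. *)
Definition is_puiseux (C : fieldType) (f : rat -> C) : Prop :=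
  exists m : nat, (0 < m)%N /\ exists n : int, forall r : rat, f r != 0 ->
    exists2 j : int, n <= j & r = j%:~R / m%:R.

Record puiseux (C : fieldType) :=
  Puiseux { puiseux_coef :> rat -> C; _ : `[< is_puiseux puiseux_coef >] }.

HB.instance Definition _ (C : fieldType) := [isSub for @puiseux_coef C].
HB.instance Definition _ (C : fieldType) := [Choice of puiseux C by <:].

Section PuiseuxRing.
Variable C : fieldType.

(* The coefficient function of q^(-n/(m+1)) F(q^(1/(m+1))). *)
Definition lser (m n : nat) (F : {fps C}) (r : rat) : C :=
  let x := r * m.+1%:R + n%:R in
  if x \is a Num.nat then F (Num.truncn x) else 0.

Definition lsupp (m n : nat) (f : rat -> C) :=
  forall r, f r != 0 -> r * m.+1%:R + n%:R \is a Num.nat.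

Definition lexp (m n i : nat) : rat := (i%:R - n%:R) / m.+1%:R.

Lemma lexpK m n i : lexp m n i * m.+1%:R + n%:R = i%:R.
Proof. by rewrite /lexp mulfVK ?pnatr_eq0 // subrK. Qed.

Lemma lexp_nat m n r : r * m.+1%:R + n%:R \is a Num.nat ->
  r = lexp m n (Num.truncn (r * m.+1%:R + n%:R)).
Proof.
by move=> xn; rewrite /lexp (truncnK xn) addrK mulfK ?pnatr_eq0.
Qed.

Lemma lexp_inj m n : injective (lexp m n).
Proof.
move=> i j /(congr1 (fun r => r * m.+1%:R + n%:R)); rewrite !lexpK.
by move/eqP; rewrite eqr_nat => /eqP.
Qed.

Lemma lser_lexp m n F i : lser m n F (lexp m n i) = F i.
Proof. by rewrite /lser lexpK natr_nat natrK. Qed.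

Lemma lser_out m n F r : r * m.+1%:R + n%:R \isn't a Num.nat ->
  lser m n F r = 0.
Proof. by rewrite /lser => /negPf ->. Qed.

Lemma lsupp_lser m n F : lsupp m n (lser m n F).
Proof. by move=> r; rewrite /lser; case: ifP => // _; rewrite eqxx. Qed.

Lemma lsuppE m n f : lsupp m n f ->
  f = lser m n (Fps (fun i => f (lexp m n i))).
Proof.
move=> sf; apply/funext => r; rewrite /lser; case: ifPn => [xn|].
  by rewrite /= -lexp_nat.
by case: (eqVneq (f r) 0) => // /sf ->.
Qed.

Lemma lsupp_widen m n f k l : lsupp m n f ->
  lsupp (m.+1 * k.+1).-1 (n * k.+1 + l) f.
Proof.
move=> sf r /sf xn; rewrite prednK ?muln_gt0 //.
have -> : r * (m.+1 * k.+1)%:R + (n * k.+1 + l)%:R =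
   (r * m.+1%:R + n%:R) * k.+1%:R + l%:R :> rat.
  by rewrite natrM natrD natrM mulrDl mulrA addrA.
by rewrite rpredD ?natr_nat // rpredM ?natr_nat.
Qed.

Lemma is_puiseuxP f : is_puiseux f <-> exists m n F, f = lser m n F.
Proof.
split=> [[m0 [m0gt [n fn]]]|[m [n [F ->]]]].
  case: m0 m0gt fn => // m _ fn.
  exists m, `|n|%N, (Fps (fun i => f (lexp m `|n| i))); apply: lsuppE.
  move=> r /fn[j nj ->]; rewrite mulfVK ?pnatr_eq0 //.
  rewrite [_%:R]pmulrn -intrD natrEint intr_int ler0z.
  rewrite (le_trans _ (lerD nj (lexx _))) //; case: (n) => k //.
  by rewrite NegzE addNr.
exists m.+1; split=> //; exists (- n%:Z) => r.
move=> /lsupp_lser xn; exists ((Num.truncn (r * m.+1%:R + n%:R))%:Z - n%:Z).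
  by rewrite lerDr.
by rewrite {1}(lexp_nat xn) /lexp intrD mulrNz !pmulrn.
Qed.

Lemma lser_common f g : is_puiseux f -> is_puiseux g ->
  exists m n F G, f = lser m n F /\ g = lser m n G.
Proof.
move=> /is_puiseuxP[m [n [F ->]]] /is_puiseuxP[m' [n' [G ->]]].
have sF := @lsupp_widen m n _ m' (n' * m.+1) (@lsupp_lser m n F).
have := @lsupp_widen m' n' _ m (n * m'.+1) (@lsupp_lser m' n' G).
rewrite (mulnC m'.+1) addnC => sG.
by do 4 eexists; split; [exact: lsuppE sF | exact: lsuppE sG].
Qed.

Lemma lser_common3 f g h : is_puiseux f -> is_puiseux g -> is_puiseux h ->
  exists m n F G H, [/\ f = lser m n F, g = lser m n G & h = lser m n H].
Proof.
move=> pf pg /is_puiseuxP[m' [n' [H ->]]].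
have [m [n [F [G [-> ->]]]]] := lser_common pf pg.
have sF := @lsupp_widen m n _ m' (n' * m.+1) (@lsupp_lser m n F).
have sG := @lsupp_widen m n _ m' (n' * m.+1) (@lsupp_lser m n G).
have := @lsupp_widen m' n' _ m (n * m'.+1) (@lsupp_lser m' n' H).
rewrite (mulnC m'.+1) addnC => sH.
do 5 eexists; split; [exact: lsuppE sF|exact: lsuppE sG|exact: lsuppE sH].
Qed.

Lemma lser_inj m n : injective (lser m n).
Proof.
by move=> F G FG; apply: fpsP => i; rewrite -(lser_lexp m n F) FG lser_lexp.
Qed.

Lemma lser_puiseux m n F : is_puiseux (lser m n F).
Proof. by apply/is_puiseuxP; exists m, n, F. Qed.

(* Only finitely many terms are nonzero when f and g are Puiseux series. *)
Definition pmul (f g : rat -> C) (r : rat) : C :=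
  \sum_(s \in [set: rat]) f s * g (r - s).

Definition pone (r : rat) : C := (r == 0)%:R.

Lemma lserD m n F G :
  (fun r => lser m n F r + lser m n G r) = lser m n (F + G).
Proof. by apply/funext => r; rewrite /lser; case: ifP; rewrite ?addr0. Qed.

Lemma lserN m n F : (fun r => - lser m n F r) = lser m n (- F).
Proof. by apply/funext => r; rewrite /lser; case: ifP; rewrite ?oppr0. Qed.

Lemma lser0 m n : (fun _ => 0) = lser m n 0.
Proof. by apply/funext => r; rewrite /lser; case: ifP. Qed.

Lemma lser1 m : pone = lser m 0 1.
Proof.
apply/funext => r; rewrite /lser /pone addr0; case: ifPn => [xn|].
  rewrite fps1E -(eqr_nat rat) (truncnK xn).
  by rewrite mulf_eq0 pnatr_eq0 orbF.
by case: eqVneq => // ->; rewrite mul0r nat_num0.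
Qed.

Lemma lexpB m n n' k i : (i <= k)%N ->
  lexp m (n + n') k - lexp m n i = lexp m n' (k - i).
Proof.
move=> ik; rewrite /lexp -mulrBl natrD natrB //; congr (_ / _).
by ring.
Qed.

Lemma lserM m n n' F G :
  pmul (lser m n F) (lser m n' G) = lser m (n + n') (F * G).
Proof.
apply/funext => r; rewrite /pmul.
have xE s : r * m.+1%:R + (n + n')%:R =
    (s * m.+1%:R + n%:R) + ((r - s) * m.+1%:R + n'%:R) :> rat.
  by rewrite natrD; ring.
have [xn|xn] := boolP (r * m.+1%:R + (n + n')%:R \is a Num.nat); last first.
  rewrite lser_out // fsbig1 // => s _.
  have [sn|sn] := boolP (s * m.+1%:R + n%:R \is a Num.nat); last first.
    by rewrite lser_out // mul0r.
  rewrite [X in _ * X]lser_out ?mulr0 //; apply: contra xn => tn.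
  by rewrite (xE s) rpredD.
rewrite (lexp_nat xn) lser_lexp; set k := Num.truncn _.
pose S := [seq lexp m n i | i <- iota 0 k.+1].
rewrite (@fsbigE _ _ _ _ _ S) //; first last.
- move=> s _ sS.
  have [sn|sn] := boolP (s * m.+1%:R + n%:R \is a Num.nat); last first.
    by rewrite lser_out // mul0r.
  rewrite [X in _ * X]lser_out ?mulr0 //; apply: contra sS => tn.
  rewrite (lexp_nat sn) map_f // mem_iota add0n ltnS leq0n andTb.
  rewrite -(ler_nat rat) (truncnK sn) /k (truncnK xn) (xE s) lerDl.
  by move: tn; rewrite -lexp_nat // => /natr_ge0.
- by rewrite map_inj_uniq ?iota_uniq //; apply: lexp_inj.
rewrite (eq_bigl predT); last by move=> s; rewrite in_setT.
rewrite /S big_map -[X in iota 0 X]subn0 -/(index_iota 0 k.+1) big_mkord.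
apply: eq_bigr => i _; rewrite lser_lexp lexpB ?lser_lexp //.
by rewrite -ltnS.
Qed.

Lemma puiseux_ext (f g : puiseux C) : (f : rat -> C) = g -> f = g.
Proof. exact: val_inj. Qed.

Lemma puiseuxE (f : puiseux C) : is_puiseux f.
Proof. by case: f => f /= /asboolP. Qed.

Lemma puiseux_add_subproof (f g : puiseux C) :
  `[< is_puiseux (fun r => f r + g r) >].
Proof.
have [m [n [F [G [-> ->]]]]] := lser_common (puiseuxE f) (puiseuxE g).
by apply/asboolP; rewrite lserD; apply: lser_puiseux.
Qed.

Lemma puiseux_opp_subproof (f : puiseux C) : `[< is_puiseux (fun r => - f r) >].
Proof.
have [m [n [F ->]]] := (is_puiseuxP f).1 (puiseuxE f).
by apply/asboolP; rewrite lserN; apply: lser_puiseux.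
Qed.

Lemma puiseux_zero_subproof : `[< is_puiseux (fun _ : rat => 0 : C) >].
Proof. by apply/asboolP; rewrite (lser0 0 0); apply: lser_puiseux. Qed.

Lemma puiseux_one_subproof : `[< is_puiseux pone >].
Proof. by apply/asboolP; rewrite (lser1 0); apply: lser_puiseux. Qed.

Lemma puiseux_mul_subproof (f g : puiseux C) : `[< is_puiseux (pmul f g) >].
Proof.
have [m [n [F [G [-> ->]]]]] := lser_common (puiseuxE f) (puiseuxE g).
by apply/asboolP; rewrite lserM; apply: lser_puiseux.
Qed.

Definition puiseux_zero := Puiseux puiseux_zero_subproof.
Definition puiseux_one := Puiseux puiseux_one_subproof.
Definition puiseux_opp f := Puiseux (puiseux_opp_subproof f).
Definition puiseux_add f g := Puiseux (puiseux_add_subproof f g).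
Definition puiseux_mul f g := Puiseux (puiseux_mul_subproof f g).

Fact puiseux_addA : associative puiseux_add.
Proof. by move=> f g h; apply/puiseux_ext/funext => r /=; rewrite addrA. Qed.
Fact puiseux_addC : commutative puiseux_add.
Proof. by move=> f g; apply/puiseux_ext/funext => r /=; rewrite addrC. Qed.
Fact puiseux_add0 : left_id puiseux_zero puiseux_add.
Proof. by move=> f; apply/puiseux_ext/funext => r /=; rewrite add0r. Qed.
Fact puiseux_addN : left_inverse puiseux_zero puiseux_opp puiseux_add.
Proof. by move=> f; apply/puiseux_ext/funext => r /=; rewrite addNr. Qed.

HB.instance Definition _ := GRing.isZmodule.Build (puiseux C)
  puiseux_addA puiseux_addC puiseux_add0 puiseux_addN.

Fact puiseux_mulA : associative puiseux_mul.
Proof.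
move=> f g h; apply: puiseux_ext => /=.
have [m [n [F [G [H [-> -> ->]]]]]] :=
  lser_common3 (puiseuxE f) (puiseuxE g) (puiseuxE h).
by rewrite !lserM mulrA addnA.
Qed.

Fact puiseux_mulC : commutative puiseux_mul.
Proof.
move=> f g; apply: puiseux_ext => /=.
have [m [n [F [G [-> ->]]]]] := lser_common (puiseuxE f) (puiseuxE g).
by rewrite !lserM mulrC.
Qed.

Fact puiseux_mul1 : left_id puiseux_one puiseux_mul.
Proof.
move=> f; apply: puiseux_ext => /=.
have [m [n [F ->]]] := (is_puiseuxP f).1 (puiseuxE f).
by rewrite (lser1 m) lserM mul1r add0n.
Qed.

Fact puiseux_mulDl : left_distributive puiseux_mul puiseux_add.
Proof.
move=> f g h; apply: puiseux_ext => /=.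
have [m [n [F [G [H [-> -> ->]]]]]] :=
  lser_common3 (puiseuxE f) (puiseuxE g) (puiseuxE h).
by rewrite lserD !lserM lserD mulrDl.
Qed.

Fact puiseux_one_neq0 : puiseux_one != 0.
Proof.
apply/eqP => /(congr1 (fun f : puiseux C => f 0)) /= /eqP.
by rewrite /pone eqxx oner_eq0.
Qed.

HB.instance Definition _ := GRing.Zmodule_isComNzRing.Build (puiseux C)
  puiseux_mulA puiseux_mulC puiseux_mul1 puiseux_mulDl puiseux_one_neq0.

Definition fpsX (v : nat) : {fps C} := Fps (fun i => (i == v)%:R).

Lemma fpsXM v (F : {fps C}) i :
  (fpsX v * F) i = if (v <= i)%N then F (i - v)%N else 0.
Proof.
rewrite fpsME; case: leqP => [vi|iv]; last first.
  rewrite big1 // => j _; rewrite /= (_ : (_ == _) = false) ?mul0r //.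
  by apply/eqP => jv; have := ltn_ord j; rewrite jv ltnS leqNgt iv.
have vi' : (v < i.+1)%N by [].
rewrite (bigD1 (Ordinal vi')) //= eqxx mul1r big1 ?addr0 // => j.
by rewrite -val_eqE /= => /negPf ->; rewrite mul0r.
Qed.

Lemma lserX m n : lser m n (fpsX n) = pone.
Proof.
apply/funext => r; rewrite /lser /pone; case: ifPn => [xn|].
  rewrite /= -(eqr_nat rat) (truncnK xn).
  rewrite -[X in _ == X]add0r (inj_eq (addIr _)).
  by rewrite mulf_eq0 pnatr_eq0 orbF.
by case: eqVneq => // ->; rewrite mul0r add0r natr_nat.
Qed.

Fact puiseux_inv_exists (f : puiseux C) : f != 0 -> exists g, g * f = 1.
Proof.
have [m [n [F fE]]] := (is_puiseuxP f).1 (puiseuxE f) => f0.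
have exF : exists i, F i != 0.
  apply: contrapT => F0; case/eqP: f0; apply/puiseux_ext.
  rewrite fE [RHS](lser0 m n); congr lser; apply: fpsP => i.
  by apply/eqP/negPn/negP => Fi; case: F0; exists i.
pose v := ex_minn exF; pose G : {fps C} := Fps (fun i => F (v + i)%N).
have [Fv minv] : F v != 0 /\ forall i, F i != 0 -> (v <= i)%N.
  by rewrite /v; case: ex_minnP.
have FE : F = fpsX v * G.
  apply: fpsP => i; rewrite fpsXM; case: leqP => [vi|iv] /=.
    by rewrite subnKC.
  by apply/eqP; apply: contraTT iv => /minv; rewrite -leqNgt.
have [|H HG] := @fps_inv_exists _ G; first by rewrite /= addn0.
have pg : `[< is_puiseux (lser m v (fpsX n * H)) >].
  by apply/asboolP; apply: lser_puiseux.
exists (Puiseux pg); apply: puiseux_ext => /=.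
rewrite fE FE lserM mulrACA HG mulr1 -[RHS](lserX m (v + n)).
congr lser; apply: fpsP => i; rewrite fpsXM /=.
case: leqP => ni; first by rewrite -(eqn_add2r n) subnK.
by case: eqP => // iE; move: ni; rewrite iE ltnNge leq_addl.
Qed.

Definition puiseux_inv (f : puiseux C) : puiseux C :=
  if pselect (f != 0) is left f0 then projT1 (cid (puiseux_inv_exists f0))
  else 0.

Fact puiseux_mulVf f : f != 0 -> puiseux_inv f * f = 1.
Proof.
by move=> f0; rewrite /puiseux_inv; case: pselect => // f0'; case: cid.
Qed.

Fact puiseux_inv0 : puiseux_inv 0 = 0.
Proof.
rewrite /puiseux_inv; case: pselect => // z.
by exfalso; move: z; rewrite eqxx.
Qed.

HB.instance Definition _ :=
  GRing.ComNzRing_isField.Build (puiseux C) puiseux_mulVf puiseux_inv0.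

Lemma puiseux0E r : (0 : puiseux C) r = 0. Proof. by []. Qed.
Lemma puiseux1E r : (1 : puiseux C) r = (r == 0)%:R. Proof. by []. Qed.
Lemma puiseuxDE (f g : puiseux C) r : (f + g) r = f r + g r.
Proof. by []. Qed.
Lemma puiseuxME (f g : puiseux C) r :
  (f * g) r = \sum_(s \in [set: rat]) f s * g (r - s).
Proof. by []. Qed.

End PuiseuxRing.

Section Rational.
Variable C : fieldType.

Lemma pmonom_subproof (c : C) (e : rat) :
  `[< is_puiseux (fun r => if r == e then c else 0) >].
Proof.
apply/asboolP; exists `|denq e|%N; split; first by rewrite absz_gt0 denq_neq0.
exists (numq e) => r; case: ifP => [/eqP -> _|]; last by rewrite eqxx.
by exists (numq e) => //; rewrite pmulrn absz_denq divq_num_den.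
Qed.

(* c q^e *)
Definition pmonom (c : C) (e : rat) : puiseux C :=
  Puiseux (pmonom_subproof c e).

Definition pconst (c : C) : puiseux C := pmonom c 0.
Definition pq : puiseux C := pmonom 1 1.

Lemma pmonomM c d e e' : pmonom c e * pmonom d e' = pmonom (c * d) (e + e').
Proof.
apply/puiseux_ext/funext => r; rewrite puiseuxME.
rewrite (fsbigE [:: e]) //=; last first.
  by move=> s _; rewrite inE => /negPf ->; rewrite mul0r.
rewrite big_cons big_nil in_setT eqxx addr0 subr_eq addrC.
by case: ifP; rewrite ?mulr0.
Qed.

Fact pconst_zmod_morphism : zmod_morphism pconst.
Proof.
move=> c d; apply/puiseux_ext/funext => r /=.
by case: ifP; rewrite ?subr0.
Qed.

Fact pconst_monoid_morphism : monoid_morphism pconst.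
Proof.
split=> [|c d]; last by rewrite /pconst pmonomM addr0.
by apply/puiseux_ext/funext => r /=; rewrite /pone; case: eqP.
Qed.

HB.instance Definition _ :=
  GRing.isZmodMorphism.Build C (puiseux C) pconst pconst_zmod_morphism.
HB.instance Definition _ :=
  GRing.isMonoidMorphism.Build C (puiseux C) pconst pconst_monoid_morphism.

Lemma pqX i : pq ^+ i = pmonom 1 i%:R.
Proof.
elim: i => [|i IH]; first exact/esym/(rmorph1 pconst).
by rewrite exprS IH pmonomM mul1r -natr1 addrC.
Qed.

Definition poly_puiseux (p : {poly C}) : puiseux C := (map_poly pconst p).[pq].

Fact poly_puiseux_zmod_morphism : zmod_morphism poly_puiseux.
Proof. by move=> p s; rewrite /poly_puiseux rmorphB hornerD hornerN. Qed.

Fact poly_puiseux_monoid_morphism : monoid_morphism poly_puiseux.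
Proof.
by split=> [|p s]; rewrite /poly_puiseux ?rmorph1 ?hornerC // rmorphM hornerM.
Qed.

HB.instance Definition _ := GRing.isZmodMorphism.Build {poly C} (puiseux C)
  poly_puiseux poly_puiseux_zmod_morphism.
HB.instance Definition _ := GRing.isMonoidMorphism.Build {poly C} (puiseux C)
  poly_puiseux poly_puiseux_monoid_morphism.

Lemma puiseux_sumE (I : Type) (s : seq I) (F : I -> puiseux C) r :
  (\sum_(i <- s) F i) r = \sum_(i <- s) F i r.
Proof. by elim/big_rec2: _ => // i x y _ <-. Qed.

Lemma poly_puiseuxE p i : poly_puiseux p i%:R = p`_i.
Proof.
rewrite /poly_puiseux horner_coef size_map_poly puiseux_sumE.
under eq_bigr => j _ do
  rewrite coef_map pqX pmonomM add0r mulr1 /= eqr_nat.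
case: (ltnP i (size p)) => [ip|pi].
  rewrite (bigD1 (Ordinal ip)) //= eqxx big1 ?addr0 // => j.
  by rewrite -val_eqE /= eq_sym => /negPf ->.
rewrite nth_default // big1 // => j _.
by case: eqP => // ij; have := ltn_ord j; rewrite -ij ltnNge pi.
Qed.

Lemma poly_puiseux_eq0 p : (poly_puiseux p == 0) = (p == 0).
Proof.
apply/eqP/eqP => [p0|->]; last by rewrite rmorph0.
by apply/polyP => i; rewrite -poly_puiseuxE p0 coef0.
Qed.

(* The inclusion of C(q) into the Puiseux series. *)
Definition ratfun_puiseux (x : {fraction {poly C}}) : puiseux C :=
  poly_puiseux (\n_(repr x)) / poly_puiseux (\d_(repr x)).

Lemma poly_puiseux_denom (x : {ratio {poly C}}) : poly_puiseux (\d_x) != 0.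
Proof. by rewrite poly_puiseux_eq0 denom_ratioP. Qed.

Lemma ratfun_puiseux_pi (x : {ratio {poly C}}) :
  ratfun_puiseux (\pi x)%qT = poly_puiseux (\n_x) / poly_puiseux (\d_x).
Proof.
rewrite /ratfun_puiseux; apply/eqP.
rewrite eqr_div ?poly_puiseux_denom // -!rmorphM /=.
by rewrite (FracField.equivf_l x) mulrC.
Qed.

Fact ratfun_puiseux_zmod_morphism : zmod_morphism ratfun_puiseux.
Proof.
elim/quotW=> x; elim/quotW=> y.
rewrite -[X in ratfun_puiseux (_ + X)]FracField.pi_opp.
rewrite -[X in ratfun_puiseux X]FracField.pi_add.
rewrite !ratfun_puiseux_pi /FracField.addf /FracField.oppf.
rewrite !numden_Ratio ?mulf_neq0 ?denom_ratioP //.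
rewrite -mulNr addf_div ?poly_puiseux_denom //.
by rewrite !rmorphD /= !rmorphM /= rmorphN.
Qed.

Fact ratfun_puiseux_monoid_morphism : monoid_morphism ratfun_puiseux.
Proof.
split.
  rewrite -[1]/(FracField.tofrac 1); unlock FracField.tofrac.
  by rewrite ratfun_puiseux_pi !numden_Ratio ?oner_eq0 // !rmorph1 divr1.
elim/quotW=> x; elim/quotW=> y.
rewrite -[X in ratfun_puiseux X]FracField.pi_mul.
rewrite !ratfun_puiseux_pi /FracField.mulf.
rewrite !numden_Ratio ?mulf_neq0 ?denom_ratioP //.
by rewrite mulf_div !rmorphM.
Qed.

HB.instance Definition _ := GRing.isZmodMorphism.Build {fraction {poly C}}
  (puiseux C) ratfun_puiseux ratfun_puiseux_zmod_morphism.
HB.instance Definition _ := GRing.isMonoidMorphism.Build {fraction {poly C}}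
  (puiseux C) ratfun_puiseux ratfun_puiseux_monoid_morphism.

End Rational.

Section AlgClosure.
Variable C : fieldType.

Definition alg_puiseux : {pred puiseux C} :=
  fun x => `[< algebraicOver (@ratfun_puiseux C) x >].

Fact alg_puiseux_divring_closed : divring_closed alg_puiseux.
Proof.
split=> [|x y|x y].
- exact/asboolP/algebraic1.
- by move=> /asboolP ax /asboolP ay; apply/asboolP/algebraic_sub.
- by move=> /asboolP ax /asboolP ay; apply/asboolP/algebraic_div.
Qed.

HB.instance Definition _ := GRing.isDivringClosed.Build (puiseux C) alg_puiseux
  alg_puiseux_divring_closed.

Record puiseux_alg := PuiseuxAlg {
  puiseux_alg_val :> puiseux C; _ : puiseux_alg_val \in alg_puiseux }.

HB.instance Definition _ := [isSub for puiseux_alg_val].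
HB.instance Definition _ := [Choice of puiseux_alg by <:].
HB.instance Definition _ :=
  [SubChoice_isSubIntegralDomain of puiseux_alg by <:].
HB.instance Definition _ :=
  [SubIntegralDomain_isSubField of puiseux_alg by <:].

End AlgClosure.

(* The algebraic closure of C(q) in the Puiseux series, for C the complex
   numbers over R. *)
Notation kk R := (puiseux_alg R[i]).

(* Main.v *)
Require Import Defs.
From HB Require Import structures.
From mathcomp Require Import all_boot all_order all_algebra.
From mathcomp Require Import boolp.
From mathcomp Require Import reals.
From mathcomp Require Import complex.
From mathcomp Require Import ring zify.
Import Order.TTheory GRing.Theory Num.Theory.
Local Open Scope ring_scope.

(** Write f a b for c_{a,b}(0, z).  The last condition says that every column
    f^~ b has products over windows of N = M + 1 consecutive indices given by
    h^~ b.  Such a sequence is determined, uniquely and without obstruction, by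
    its values on any M consecutive indices: dividing two adjacent windows
    gives the recursion f (a + N) / f a = h (a + 1) / h a
    ([window_exists], [window_uniq]).

    Conversely, two-variable series c with c a a = 1 and
    c a b (u, v) * c b a (v, u) = 1 can be found above any one-variable f with
    f a a = 1 whose constant terms satisfy f a b (0) * f b a (0) = 1: take
    c a b (u, v) = f a b (v) * f b a (0) / f b a (u) ([two_variable_lift]).
    So the symmetry constrains only the constant terms, and once these are known
    the higher terms are obtained one column at a time: column b is started on
    [b, b + M) from the constants x a b, which makes f b b = 1 because M > 0,
    and by uniqueness of the recursion its constant terms are x a b everywhere
    ([alternating_fps_window_exists]).

    What remains is the array x of constants, with x a a = 1,
    x a b * x b a = 1 and column windows y a b = h a b (0)
    ([alternating_window_exists]).  Put x = 1 on the square [0, M)^2.  The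
    recursion extends it to the columns with index in [0, M), the symmetry then
    gives the rows with index in [0, M), and the recursion gives all the columns.
    The array z a b = x a b * x b a is 1 on the rows and the columns with index
    in [0, M), and the product of z over an N x N square is
    lambda a b * lambda b a = 1; uniqueness of the recursion, used in each of
    the two directions, yields z = 1.  Given this, the product of x over a
    diagonal N x N square, which is lambda a a = 1, collapses to the product of
    the diagonal entries, so the diagonal is a sequence with trivial windows
    and M trivial consecutive values, hence trivial. *)

Set Implicit Arguments.
Unset Strict Implicit.
Unset Printing Implicit Defensive.

(** * Bi-infinite sequences with prescribed window products *)

Definition window (A : comNzRingType) (N : nat) (g : int -> A) (a : int) : A :=
  \prod_(i < N) g (a + i%:Z).

Lemma windowSl (A : comNzRingType) (M : nat) (g : int -> A) (a : int) :
  window M.+1 g a = g a * window M g (a + 1).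
Proof.
rewrite /window big_ord_recl addr0; congr (_ * _).
by apply: eq_bigr => i _; rewrite lift0 -addrA -natz -[i%:Z]natz nat1r.
Qed.

Lemma windowSr (A : comNzRingType) (M : nat) (g : int -> A) (a : int) :
  window M.+1 g a = window M g a * g (a + M%:Z).
Proof. by rewrite /window big_ord_recr. Qed.

Lemma windowM (A : comNzRingType) (M : nat) (g k : int -> A) (a : int) :
  window M (fun j => g j * k j) a = window M g a * window M k a.
Proof. by rewrite /window big_split. Qed.

Lemma window1 (A : comNzRingType) (M : nat) (a : int) :
  window M (fun=> 1 : A) a = 1.
Proof. by rewrite /window big1. Qed.

Lemma window_unit (A : comUnitRingType) (M : nat) (g : int -> A) :
  (forall a, window M.+1 g a \is a GRing.unit) ->
  forall a, g a \is a GRing.unit.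
Proof. by move=> gU a; move: (gU a); rewrite windowSl unitrM => /andP[]. Qed.

Lemma int_step_ind (P : int -> Prop) (m : int) :
  P m -> (forall z, P z <-> P (z + 1)) -> forall z, P z.
Proof.
move=> Pm Pstep z; rewrite -[z](subrK m) addrC.
elim/int_rect: (z - m) => [|n IH|n IH]; first by rewrite addr0.
  by rewrite intS (addrC 1) addrA; apply: (Pstep _).1.
apply: (Pstep _).2; rewrite (_ : _ + 1 = m + - n%:Z) //; lia.
Qed.

(** In a window of M + 1 units, either end is determined by the product and
    the other M terms, so agreement on M consecutive indices propagates by one
    step to the right and to the left. *)
Lemma window_uniq (A : comUnitRingType) (M : nat) (m : int) (g k : int -> A) :
  (forall a, window M.+1 g a \is a GRing.unit) ->
  (forall a, window M.+1 g a = window M.+1 k a) ->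
  (forall i : nat, (i < M)%N -> g (m + i%:Z) = k (m + i%:Z)) ->
  forall a, g a = k a.
Proof.
move=> gU gk init.
have kU : forall a, window M.+1 k a \is a GRing.unit by move=> a; rewrite -gk.
have {}gU := window_unit gU; have {}kU := window_unit kU.
have wE a : window M g a = window M k a <-> g (a + M%:Z) = k (a + M%:Z).
  have := gk a; rewrite !windowSr => e; split=> e'; rewrite e' in e.
    by apply: (mulrI _ e); apply: rpred_prod => i _; apply: kU.
  exact: mulIr e.
have wE1 a : g a = k a <-> window M g (a + 1) = window M k (a + 1).
  have := gk a; rewrite !windowSl => e; split=> e'; rewrite e' in e.
    exact: mulrI e.
  by apply: (mulIr _ e); apply: rpred_prod => i _; apply: kU.
pose agree z := forall i : nat, (i < M)%N -> g (z + i%:Z) = k (z + i%:Z).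
have agreeW z : agree z -> g (z + M%:Z) = k (z + M%:Z).
  by move=> zi; apply/wE/eq_bigr => i _; apply: zi.
(* Stated for the M terms so that M = 0, with no initial values, is covered. *)
suff all_agree z : agree z.
  by move=> a; rewrite -[a](subrK M%:Z); apply/agreeW/all_agree.
move: z; apply: (@int_step_ind _ m) => // z; split=> zi i iM.
  rewrite -addrA -intS.
  by case: (ltngtP i.+1 M) iM => // [/zi // | -> _]; apply: agreeW.
case: i iM => [_|i iM].
  rewrite addr0; apply/wE1/eq_bigr => j _; exact: zi.
by rewrite intS addrA; apply: zi; apply: ltnW.
Qed.

Lemma telescope_exists (A : comUnitRingType) (v0 : A) (u : int -> A) :
  v0 \is a GRing.unit -> (forall z, u z \is a GRing.unit) ->
  exists v : int -> A,
    [/\ v 0 = v0, forall z, v z \is a GRing.unit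
      & forall z, v (z + 1) = v z * u z].
Proof.
move=> v0U uU.
pose v (z : int) := match z with
  | Posz n => v0 * \prod_(i < n) u (Posz i)
  | Negz n => v0 / \prod_(i < n.+1) u (Negz i)
  end.
have v_0 : v 0 = v0 by rewrite -[0]/(Posz 0) /= big_ord0 mulr1.
have vS z : v (z + 1) = v z * u z.
  case: z => [n|[|n]].
  - by rewrite addrC -intS /= big_ord_recr mulrA.
  - by rewrite v_0 /= big_ord1 divrK.
  rewrite (_ : Negz n.+1 + 1 = Negz n) /=; last by lia.
  have prodU : \prod_(i < n.+1) u (Negz i) \is a GRing.unit.
    by apply: rpred_prod => i _.
  by rewrite [in RHS]big_ord_recr /= invrM // mulrA mulrAC divrK.
exists v; split=> //; apply: (@int_step_ind _ 0) => [|z]; first by rewrite v_0.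
by rewrite vS unitrM uU andbT.
Qed.

(** Quotients of adjacent windows prescribe g (a + N) / g a for N = M + 1, so
    each residue class modulo N is a telescoping problem with a free starting
    value.  The classes m, ..., m + M - 1 start from the given values and the
    class of m + M from the value that makes the window at m correct. *)
Lemma window_exists (A : comUnitRingType) (M : nat) (m : int)
    (g0 H : int -> A) :
  (forall a, g0 a \is a GRing.unit) -> (forall a, H a \is a GRing.unit) ->
  exists g : int -> A,
    (forall i : nat, (i < M)%N -> g (m + i%:Z) = g0 (m + i%:Z)) /\
    (forall a, window M.+1 g a = H a).
Proof.
move=> g0U HU; pose N : int := M.+1%:Z.
pose init (r : int) :=
  if r == M%:Z then H m / window M g0 m else g0 (m + r).
have winU : window M g0 m \is a GRing.unit by apply: rpred_prod.
have initU r : init r \is a GRing.unit.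
  by rewrite /init; case: ifP => _ //; rewrite unitrM unitrV HU.
have col r : exists v : int -> A, [/\ v 0 = init r,
    forall q, v q \is a GRing.unit & forall q,
    v (q + 1) = v q * (H (m + (q * N + r) + 1) / H (m + (q * N + r)))].
  by apply: telescope_exists => // q; rewrite unitrM unitrV !HU.
have [V Vcol] := choice col.
have V0 r : V r 0 = init r by case: (Vcol r).
have VU r q : V r q \is a GRing.unit by case: (Vcol r).
have VS r q :
    V r (q + 1) = V r q * (H (m + (q * N + r) + 1) / H (m + (q * N + r))).
  by case: (Vcol r).
(* The quotient by N is the position inside the residue class. *)
pose g a := V ((a - m) %% N)%Z ((a - m) %/ N)%Z.
have gU a : g a \is a GRing.unit by apply: VU.
have gN a : g (a + N) * H a = g a * H (a + 1).
  have N0 : N != 0 by [].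
  have e : a + N - m = 1 * N + (a - m) by ring.
  rewrite /g e modzMDl divzMDl // [1 + _]addrC VS -divz_eq.
  by rewrite (addrC m) subrK -mulrA divrK.
have gi (r : nat) : (r < M.+1)%N -> g (m + r%:Z) = init r.
  move=> rM; rewrite /g addrAC subrr add0r.
  by rewrite modz_small ?divz_small ?V0 //; apply/andP; split; lia.
have g_init (i : nat) : (i < M)%N -> g (m + i%:Z) = g0 (m + i%:Z).
  move=> iM; rewrite (gi _ (leqW iM)) /init; case: eqP => // -[iE].
  by rewrite iE ltnn in iM.
exists g; split=> //.
have gstep a : g a * window M.+1 g (a + 1) = window M.+1 g a * g (a + N).
  by rewrite windowSr windowSl -addrA -intS mulrA.
apply: (@int_step_ind _ m) => [|z].
  rewrite windowSr (gi M (leqnn _)) /init eqxx.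
  rewrite (_ : window M g m = window M g0 m).
    by rewrite mulrC divrK.
  by apply: eq_bigr => i _; apply: g_init.
split=> e; move: (gstep z); rewrite e.
  by rewrite mulrC (mulrC (H z)) gN mulrC => /mulrI; apply.
by rewrite -gN mulrC => /mulIr e'; rewrite e'.
Qed.

(** * Alternating arrays with prescribed column windows *)

Lemma window_eq1 (A : comUnitRingType) (M : nat) (m : int) (g : int -> A) :
  (forall a, window M.+1 g a = 1) ->
  (forall i : nat, (i < M)%N -> g (m + i%:Z) = 1) ->
  forall a, g a = 1.
Proof.
move=> g1 init; apply: (@window_uniq _ M m _ (fun=> 1)) => // a.
  by rewrite g1 unitr1.
by rewrite g1 window1.
Qed.

(** Off the diagonal the factors cancel in pairs. *)
Lemma prod_alternating (A : comNzRingType) (f : nat -> nat -> A) (n : nat) :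
  (forall i j, f i j * f j i = 1) ->
  \prod_(i < n) \prod_(j < n) f i j = \prod_(i < n) f i i.
Proof.
move=> fV; elim: n => [|n IH]; first by rewrite !big_ord0.
rewrite !big_ord_recr /= -IH.
under eq_bigr => i _ do rewrite big_ord_recr /=.
rewrite big_split /= -mulrA; congr (_ * _).
by rewrite mulrA -big_split /= big1 ?mul1r.
Qed.

(** The solution equal to 1 on the square [0, M)^2: that square determines the
    columns with index in [0, M), by symmetry the rows with index in [0, M), and
    hence all the columns.  The conditions on the windows of the rows of y are
    also necessary: window M.+1 (y a) b is the product of x over the square of
    side M + 1 starting at (a, b). *)
Lemma alternating_window_exists (A : comUnitRingType) (M : nat)
    (y : int -> int -> A) :
  (forall a b, y a b \is a GRing.unit) ->
  (forall a, window M.+1 (y a) a = 1) ->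
  (forall a b, window M.+1 (y a) b * window M.+1 (y b) a = 1) ->
  exists x : int -> int -> A,
    [/\ forall a, x a a = 1, forall a b, x a b * x b a = 1
      & forall a b, window M.+1 (x^~ b) a = y a b].
Proof.
move=> yU yd yV.
(* Only the columns p b with b in [0, M) belong to the array; the others serve
   to make p total. *)
have [p pP] := choice (fun b : int =>
  @window_exists A M 0 (fun=> 1) (y^~ b) (fun=> unitr1 A) (yU^~ b)).
have p1 b (i : nat) : (i < M)%N -> p b i%:Z = 1.
  by move=> iM; rewrite -[i%:Z]add0r (pP b).1.
have pW b a : window M.+1 (p b) a = y a b by rewrite (pP b).2.
have pU b a : p b a \is a GRing.unit.
  by move: a; apply: (@window_unit _ M) => a; rewrite pW.
have pVU b a : (p a b)^-1 \is a GRing.unit by rewrite unitrV.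
(* Column b of the array, whose entries on [0, M) come from the symmetry. *)
have [q qP] := choice (fun b : int =>
  @window_exists A M 0 (fun j => (p j b)^-1) (y^~ b) (pVU b) (yU^~ b)).
have qE b (i : nat) : (i < M)%N -> q b i%:Z = (p i%:Z b)^-1.
  by move=> iM; rewrite -[i%:Z]add0r (qP b).1.
have qW b a : window M.+1 (q b) a = y a b by rewrite (qP b).2.
(* On the columns with index in [0, M) both constructions coincide. *)
have qp (i : nat) : (i < M)%N -> q i%:Z =1 p i%:Z.
  move=> iM; apply: (@window_uniq _ M 0) => [a|a|j jM].
  - by rewrite qW.
  - by rewrite qW pW.
  by rewrite !add0r qE // !p1 // invr1.
pose z a b := q b a * q a b.
have zV a b : z a b = z b a by rewrite /z mulrC.
have z_strip (i : nat) b : (i < M)%N -> z i%:Z b = 1.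
  by move=> iM; rewrite /z qE // qp // mulVr.
(* The product of z over an (M + 1)-square. *)
have zWW a b : window M.+1 (fun j => window M.+1 (z j) b) a = 1.
  rewrite -(yV a b).
  transitivity (window M.+1 (fun j => window M.+1 (fun k => q k j) b) a *
                window M.+1 (fun j => window M.+1 (fun k => q j k) b) a).
    by rewrite -windowM; apply: eq_bigr => i _; rewrite windowM.
  congr (_ * _); last by apply: eq_bigr => i _; rewrite qW.
  rewrite /window exchange_big; apply: eq_bigr => i _.
  exact: qW.
have zW a b : window M.+1 (z a) b = 1.
  move: a; apply: (@window_eq1 _ M 0) => [a|i iM]; first exact: zWW.
  by rewrite add0r; apply: big1 => j _; apply: z_strip.
have z1 a b : z a b = 1.
  move: b; apply: (@window_eq1 _ M 0) => // i iM.
  by rewrite add0r zV z_strip.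
have q_diag a : q a a = 1.
  move: a; apply: (@window_eq1 _ M 0) => [a|i iM]; last first.
    by rewrite add0r qp // p1.
  rewrite -(yd a) /window.
  rewrite -(@prod_alternating _ (fun i j => q (a + i%:Z) (a + j%:Z))).
    by apply: eq_bigr => i _; apply: qW.
  by move=> i j; apply: z1.
by exists (fun a b => q b a).
Qed.

(** * Power series in one and two variables *)

Section FpsMorphisms.
Variable A : comNzRingType.

Definition fps_const (c : A) : {fps A} := Fps (fun i => if i is 0 then c else 0).

Fact fps_const_zmod_morphism : zmod_morphism fps_const.
Proof. by move=> c d; apply: fpsP => -[|i] //=; rewrite oppr0 addr0. Qed.

Fact fps_const_monoid_morphism : monoid_morphism fps_const.
Proof.
split=> [|c d]; apply: fpsP => -[|i] //.
  by rewrite fpsME big_ord1.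
rewrite fpsME big_ord_recl /= mulr0 big1 ?addr0 // => j _.
by rewrite mul0r.
Qed.

HB.instance Definition _ :=
  GRing.isZmodMorphism.Build A {fps A} fps_const fps_const_zmod_morphism.
HB.instance Definition _ :=
  GRing.isMonoidMorphism.Build A {fps A} fps_const fps_const_monoid_morphism.

Fact fps_at0_zmod_morphism : zmod_morphism (@fps_at0 A).
Proof. by []. Qed.

Fact fps_at0_monoid_morphism : monoid_morphism (@fps_at0 A).
Proof. by split=> // f g; rewrite /fps_at0 fpsME big_ord1. Qed.

HB.instance Definition _ :=
  GRing.isZmodMorphism.Build {fps A} A (@fps_at0 A) fps_at0_zmod_morphism.
HB.instance Definition _ :=
  GRing.isMonoidMorphism.Build {fps A} A (@fps_at0 A) fps_at0_monoid_morphism.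

Lemma fps_at0M (f g : {fps A}) : fps_at0 (f * g) = fps_at0 f * fps_at0 g.
Proof. exact: (rmorphM (@fps_at0 A)). Qed.

Lemma fps_const_at0 (c : A) : fps_at0 (fps_const c) = c.
Proof. by []. Qed.

End FpsMorphisms.

Section FpsSwap.
Variable A : comNzRingType.

Fact fps_swap_zmod_morphism : zmod_morphism (@fps_swap A).
Proof. by []. Qed.

Fact fps_swap_monoid_morphism : monoid_morphism (@fps_swap A).
Proof.
split=> [|c d]; apply: fpsP => i; apply: fpsP => j.
  by case: i j => [|i] [|j].
by rewrite [RHS]fps2ME exchange_big; apply: (fps2ME c d).
Qed.

HB.instance Definition _ := GRing.isZmodMorphism.Build {fps {fps A}}
  {fps {fps A}} (@fps_swap A) fps_swap_zmod_morphism.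
HB.instance Definition _ := GRing.isMonoidMorphism.Build {fps {fps A}}
  {fps {fps A}} (@fps_swap A) fps_swap_monoid_morphism.

Lemma fps_swapK : involutive (@fps_swap A).
Proof. by move=> c; apply: fpsP => i; apply: fpsP. Qed.

Lemma fps_swap_const2 (c : A) :
  fps_swap (fps_const (fps_const c)) = fps_const (fps_const c).
Proof. by apply: fpsP => -[|i]; apply: fpsP => -[|j]. Qed.

Lemma fps_at0_swap_const (f : {fps A}) :
  fps_at0 (fps_swap (fps_const f)) = fps_const (fps_at0 f).
Proof. by apply: fpsP => -[|i]. Qed.

End FpsSwap.

Section FpsUnits.
Variable F : fieldType.

Definition fps_unit : {pred {fps F}} := fun f => fps_at0 f != 0.

Definition fps_inv (f : {fps F}) : {fps F} :=
  if pselect (fps_at0 f != 0) is left f0 then projT1 (cid (fps_inv_exists f0))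
  else f.

Fact fps_mulVf : {in fps_unit, left_inverse 1 fps_inv *%R}.
Proof. by move=> f f0; rewrite /fps_inv; case: pselect => // ?; case: cid. Qed.

Fact fps_unitP (f g : {fps F}) : g * f = 1 -> f \in fps_unit.
Proof.
move=> /(congr1 (@fps_at0 F)); rewrite rmorphM rmorph1 => gf1.
apply/eqP => f0; move: gf1 => /eqP.
by rewrite /= f0 mulr0 eq_sym oner_eq0.
Qed.

Fact fps_inv_out : {in [predC fps_unit], fps_inv =1 id}.
Proof.
by move=> f f0; rewrite /fps_inv; case: pselect => // f1; case/negP: f0.
Qed.

HB.instance Definition _ := GRing.ComNzRing_hasMulInverse.Build {fps F}
  fps_mulVf fps_unitP fps_inv_out.

Lemma fps_unitE (f : {fps F}) : (f \is a GRing.unit) = (fps_at0 f != 0).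
Proof. by []. Qed.

End FpsUnits.

(** Each column b is started on [b, b + M) from the constant series x a b; this
    range contains b, whence f b b = 1.  The constant terms of the column satisfy
    the same recursion as x^~ b with the same initial values. *)
Lemma alternating_fps_window_exists (F : fieldType) (M : nat)
    (h : int -> int -> {fps F}) (x : int -> int -> F) :
  (0 < M)%N -> (forall a, x a a = 1) -> (forall a b, x a b != 0) ->
  (forall a b, window M.+1 (x^~ b) a = fps_at0 (h a b)) ->
  exists f : int -> int -> {fps F},
    [/\ forall a, f a a = 1, forall a b, fps_at0 (f a b) = x a b
      & forall a b, window M.+1 (f^~ b) a = h a b].
Proof.
move=> M0 xd xN0 xW.
have xWN0 a b : window M.+1 (x^~ b) a != 0 by apply/prodf_neq0.
have hU b a : h a b \is a GRing.unit by rewrite fps_unitE -xW.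
have cU b a : fps_const (x a b) \is a GRing.unit.
  by rewrite fps_unitE fps_const_at0.
have [f fP] := choice (fun b : int =>
  @window_exists _ M b (fun a => fps_const (x a b)) (h^~ b) (cU b) (hU b)).
exists (fun a b => f b a); split=> [a|a b|a b]; last by rewrite -(fP b).2.
  by have := (fP a).1 _ M0; rewrite addr0 => ->; rewrite xd rmorph1.
have fW c : window M.+1 (fun j => fps_at0 (f b j)) c = window M.+1 (x^~ b) c.
  by rewrite xW -(fP b).2 /window rmorph_prod.
move: a; apply: (@window_uniq _ M b) => // [c|i iM].
  by rewrite fW unitfE.
by rewrite (fP b).1.
Qed.

(** The witness is c a b (u, v) = f a b (v) * f b a (0) / f b a (u).  Exchanging
    the indices and the variables inverts it up to the factor
    f a b (0) * f b a (0) = 1, and at u = 0 it is f a b (v). *)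
Lemma two_variable_lift (F : fieldType) (f : int -> int -> {fps F}) :
  (forall a, f a a = 1) ->
  (forall a b, fps_at0 (f a b) * fps_at0 (f b a) = 1) ->
  exists c : int -> int -> {fps {fps F}},
    [/\ forall a, c a a = 1, forall a b, c a b * fps_swap (c b a) = 1
      & forall a b, fps_at0 (c a b) = f a b].
Proof.
move=> fd fV.
have fU a b : f a b \is a GRing.unit.
  rewrite fps_unitE; apply: contra_eq_neq (fV a b) => ->.
  by rewrite mul0r eq_sym oner_neq0.
pose w a b := fps_const (fps_at0 (f a b)) / f a b.
have fw a b : f a b * w a b = fps_const (fps_at0 (f a b)).
  by rewrite /w mulrC divrK.
have w0 a b : fps_at0 (w a b) = 1.
  apply: (@mulfI _ (fps_at0 (f a b))); first by rewrite -fps_unitE.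
  by rewrite -rmorphM fw mulr1.
(* The outer variable is u, so fps_const f is f(v) and its swap is f(u). *)
exists (fun a b => fps_const (f a b) * fps_swap (fps_const (w b a))).
split=> [a|a b|a b].
- by rewrite /w fd !rmorph1 invr1 mulr1 !rmorph1 mulr1.
- rewrite [fps_swap (_ * _)]rmorphM /= fps_swapK.
  rewrite [X in _ * X]mulrC mulrACA -!rmorphM /= fw (mulrC (w b a)) fw.
  by rewrite fps_swap_const2 -2!rmorphM fV !rmorph1.
by rewrite fps_at0M fps_const_at0 fps_at0_swap_const w0 rmorph1 mulr1.
Qed.

Unset Implicit Arguments.

Theorem lemma2p6p7 (R : realType) (n N : nat) (hN : N = (2 * n)%N)
    (hn : (2 <= n)%N) (h : int -> int -> {fps kk R})
    (lambda : int -> int -> kk R)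
    (lambdaE : forall a b : int,
       lambda a b = \prod_(i < N) fps_at0 (h a (b + i%:Z)))
    (lambda_diag : forall a : int, lambda a a = 1)
    (lambda_sym : forall a b : int, lambda a b * lambda b a = 1) :
  exists c : int -> int -> {fps {fps kk R}},
    [/\ forall a : int, c a a = 1,
        forall a b : int, c a b * fps_swap (c b a) = 1
      & forall a b : int, h a b = \prod_(i < N) fps_at0 (c (a + i%:Z) b)].
Proof.
case: N hN lambdaE => [|M] hM lambdaE; first by lia.
have M0 : (0 < M)%N by lia.
pose y a b := fps_at0 (h a b).
have lE a b : window M.+1 (y a) b = lambda a b by rewrite lambdaE.
have lU a b : lambda a b \is a GRing.unit.
  by apply/unitrPr; exists (lambda b a).
have yU a b : y a b \is a GRing.unit.
  by move: b; apply: (@window_unit _ M) => b; rewrite lE.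
have [||x [xd xV xW]] := @alternating_window_exists _ M y yU.
- by move=> a; rewrite lE.
- by move=> a b; rewrite !lE.
have xN0 a b : x a b != 0.
  by rewrite -unitfE; apply/unitrPr; exists (x b a).
have [f [fd f0 fW]] := alternating_fps_window_exists M0 xd xN0 xW.
have [|c [cd cV c0]] := two_variable_lift fd.
  by move=> a b; rewrite !f0.
exists c; split=> // a b.
by rewrite -fW; apply: eq_bigr => i _; rewrite c0.
Qed.
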